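(* Let $p,q\ge 0$, $C\ge 0$, let $T\ge 1$ be an integer, and let $V_0,\dots,V_{T-1}:[0,1]\to\mathbb{R}$ be the profit-to-go functions defined in the context, with $Q_t(F,\pi)$ the corresponding state-action value functions. Then: (1) for each $t\in\{0,\dots,T-1\}$ there is a finite $\overline{\pi}_t\ge 0$ (not depending on $F$) such that for every $F\in[0,1]$ the supremum $V_t(F)=\sup_{\pi\ge 0}Q_t(F,\pi)$ is attained at some $\pi\in[0,\overline{\pi}_t]$, i.e. $V_t(F)=\max_{\pi\in[0,\overline{\pi}_t]}Q_t(F,\pi)$; (2) $V_t(F)\ge V_{t+1}(F)$ for all $F\in[0,1]$ and all $t=0,\dots,T-2$.
   Context: Let $R(F,\pi)=\dfrac{e^{p+qF-\pi}}{1+e^{p+qF-\pi}}$ for $F\in[0,1]$, $\pi\ge 0$. The fraction of adopters evolves as $F_{t+1}=F_t+(1-F_t)R(F_t,\pi_t)$, which stays in $[0,1]$. The profit-to-go functions on $[0,1]$ are defined backward in time by $$Q_{T-1}(F,\pi)=(\pi-C)(1-F)R(F,\pi),\qquad V_{T-1}(F)=\sup_{\pi\ge 0}Q_{T-1}(F,\pi),$$ and for $t=T-2,\dots,0$, $$Q_t(F,\pi)=(\pi-C)(1-F)R(F,\pi)+V_{t+1}\big(F+(1-F)R(F,\pi)\big),\qquad V_t(F)=\sup_{\pi\ge 0}Q_t(F,\pi).$$ An optimal price at time $t$ and adoption level $F$ is a maximizer of $Q_t(F,\cdot)$ over $\pi\ge 0$. *)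

(* Defs.v *)
From HB Require Import structures.
From mathcomp Require Import all_boot all_order all_algebra.
From mathcomp Require Import all_classical all_reals all_analysis.

Set Implicit Arguments.
Unset Strict Implicit.
Unset Printing Implicit Defensive.

Import Order.TTheory GRing.Theory Num.Theory.
Local Open Scope classical_set_scope.
Local Open Scope ring_scope.

Section BassLogitPricing.
Variable R : realType.
Variables p q C : R.

Definition adopt_prob (F price : R) : R :=
  expR (p + q * F - price) / (1 + expR (p + q * F - price)).

Definition next_adopters (F price : R) : R := F + (1 - F) * adopt_prob F price.

Definition bellman_value (W : R -> R) (F price : R) : R :=
  (price - C) * (1 - F) * adopt_prob F price + W (next_adopters F price).

(* Recursion on the number k = T - t of remaining periods, with terminal value
   V_T = 0.  The functions are total on R but meaningful on [0, 1], which
   [next_adopters] preserves.  [sup] returns 0 on a set without a least upper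
   bound, so a claim on these values has content only along with the fact that
   the state-action values are bounded above. *)
Fixpoint profit_to_go_rem (k : nat) (F : R) : R :=
  if k is k'.+1 then
    sup [set bellman_value (profit_to_go_rem k') F price
        | price in [set price : R | 0 <= price]]
  else 0.

(* V_t and Q_t for horizon T; meaningful for t < T. *)
Definition profit_to_go (T t : nat) : R -> R := profit_to_go_rem (T - t).
Definition action_value (T t : nat) : R -> R -> R :=
  bellman_value (profit_to_go T t.+1).

Lemma next_adopters_in01 (F price : R) :
  0 <= F <= 1 -> 0 <= next_adopters F price <= 1.
Proof.
move=> /andP[F0 F1]; rewrite /next_adopters /adopt_prob.
set e := expR _; have e0 : 0 < e by exact: expR_gt0.
have e1 : 0 < 1 + e by rewrite addr_gt0.
have r0 : 0 <= e / (1 + e) by rewrite divr_ge0 // ltW.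
have r1 : e / (1 + e) <= 1 by rewrite ler_pdivrMr // mul1r lerDr.
apply/andP; split; first by rewrite addr_ge0 // mulr_ge0 ?subr_ge0.
by rewrite -lerBrDl ler_piMr // subr_ge0.
Qed.

Lemma action_value_last (T : nat) (F price : R) : (0 < T)%N ->
  action_value T T.-1 F price = (price - C) * (1 - F) * adopt_prob F price.
Proof.
move=> T0; rewrite /action_value /bellman_value /profit_to_go prednK //.
by rewrite subnn addr0.
Qed.

Lemma action_value_step (T t : nat) (F price : R) :
  action_value T t F price
  = (price - C) * (1 - F) * adopt_prob F price
    + profit_to_go T t.+1 (F + (1 - F) * adopt_prob F price).
Proof. by []. Qed.

Lemma profit_to_goE (T t : nat) (F : R) : (t < T)%N ->
  profit_to_go T t F
  = sup [set action_value T t F price | price in [set price : R | 0 <= price]].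
Proof. by move=> tT; rewrite /action_value /profit_to_go -(subnSK tT). Qed.

End BassLogitPricing.

(* Main.v *)
(* Boundedness of the maximizers rests on the Lipschitz continuity of the value
   functions, which passes from V_(t+1) to V_t.  If V_(t+1) is Lipschitz, a high
   price changes the continuation value by at most a multiple of the expected
   sales, so some fixed price beats every sufficiently high one, uniformly in F;
   on the remaining compact interval of prices Q_t is jointly Lipschitz in state
   and price, so a maximizer exists and the maximum V_t is again Lipschitz.
   Monotonicity in t follows from that of the Bellman operator, as charging C
   in the last period gives a nonnegative profit. *)
Require Import Defs.
From HB Require Import structures.
From mathcomp Require Import all_boot all_order all_algebra.
From mathcomp Require Import all_classical all_reals all_analysis.
From mathcomp Require Import ring lra.

Import Order.TTheory GRing.Theory Num.Theory.
Import numFieldNormedType.Exports.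
Local Open Scope classical_set_scope.
Local Open Scope ring_scope.

(** * Lipschitz estimates for one Bellman step *)

Lemma ler_dist_mul (R : realDomainType) (x x' y y' a b : R) :
  `|x'| <= a -> `|y| <= b ->
  `|x * y - x' * y'| <= b * `|x - x'| + a * `|y - y'|.
Proof.
move=> xa yb; have -> : x * y - x' * y' = (x - x') * y + x' * (y - y') by ring.
apply: (le_trans (ler_normD _ _)); rewrite !normrM.
by rewrite lerD // ?[b * _]mulrC ?ler_wpM2l ?ler_wpM2r.
Qed.

Definition lipschitz01 (R : realType) (L : R) (W : R -> R) : Prop :=
  forall F G, 0 <= F <= 1 -> 0 <= G <= 1 -> `|W F - W G| <= L * `|F - G|.

(** For [y <= x], the bound [1 + (y - x) <= expR (y - x)] gives
    [expR x - expR y <= expR x * (x - y)], and [expR x] is at most the common denominator. *)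
Lemma logistic_dist (R : realType) (x y : R) :
  `|expR x / (1 + expR x) - expR y / (1 + expR y)| <= `|x - y|.
Proof.
wlog xy : x y / y <= x => [H|].
  have [|/ltW xy] := leP y x; first exact: H.
  by rewrite distrC [leRHS]distrC; exact: H.
have ex := expR_gt0 x; have ey := expR_gt0 y.
have eyx : expR y <= expR x by rewrite ler_expR.
have -> : expR x / (1 + expR x) - expR y / (1 + expR y) =
   (expR x - expR y) / ((1 + expR x) * (1 + expR y)).
  by field; apply/andP; split; lra.
have D0 : 0 < (1 + expR x) * (1 + expR y) by rewrite mulr_gt0; lra.
rewrite !ger0_norm ?subr_ge0 ?divr_ge0 ?subr_ge0 ?(ltW D0) //.
rewrite ler_pdivrMr //.
have h : expR x - expR y <= expR x * (x - y).
  have -> : expR y = expR x * expR (y - x) by rewrite -expRD addrC subrK.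
  have := expR_ge1Dx (y - x); nra.
apply: (le_trans h); rewrite mulrC ler_wpM2l ?subr_ge0 //; nra.
Qed.

Lemma adopt_prob_itv (R : realType) (p q F price : R) :
  0 < adopt_prob p q F price < 1.
Proof.
have e0 := expR_gt0 (p + q * F - price).
rewrite /adopt_prob divr_gt0 ?ltr_pdivrMr; lra.
Qed.

Lemma adopt_prob_dist (R : realType) (p q F G x y : R) : 0 <= q ->
  `|adopt_prob p q F x - adopt_prob p q G y| <= q * `|F - G| + `|x - y|.
Proof.
move=> q0; apply: (le_trans (logistic_dist _ _ _)).
have -> : p + q * F - x - (p + q * G - y) = q * (F - G) - (x - y) by ring.
by rewrite (le_trans (ler_normB _ _)) // normrM (ger0_norm q0).
Qed.

Lemma next_adopters_dist (R : realType) (p q F G x y : R) : 0 <= q ->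
  0 <= F <= 1 -> 0 <= G <= 1 ->
  `|next_adopters p q F x - next_adopters p q G y|
  <= (1 + q) * `|F - G| + `|x - y|.
Proof.
move=> q0 F01 G01; rewrite /next_adopters.
have := adopt_prob_dist _ p q F G x y q0.
have := adopt_prob_itv _ p q F x; have := adopt_prob_itv _ p q G y.
move: (adopt_prob p q G y) (adopt_prob p q F x) => s r s01 r01 rs.
(* Passing to non-adopters turns the next state into a product of two factors in [0, 1]. *)
have -> : F + (1 - F) * r - (G + (1 - G) * s)
        = (1 - G) * (1 - s) - (1 - F) * (1 - r) by ring.
have := ler_dist_mul _ (1 - G) (1 - F) (1 - s) (1 - r) 1 1.
have -> : 1 - G - (1 - F) = F - G by ring.
have -> : 1 - s - (1 - r) = r - s by ring.
have hF : `|1 - F| <= 1 by rewrite ler_norml; lra.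
have hs : `|1 - s| <= 1 by rewrite ler_norml; lra.
move=> /(_ hF hs); lra.
Qed.

Lemma bellman_value_dist (R : realType) (p q C L M : R) (W : R -> R) :
  0 <= q -> 0 <= C -> 0 <= L -> 0 <= M -> lipschitz01 R L W ->
  exists2 K : R, 0 <= K & forall F G x y : R,
    0 <= F <= 1 -> 0 <= G <= 1 -> 0 <= x <= M -> 0 <= y <= M ->
    `|bellman_value p q C W F x - bellman_value p q C W G y|
    <= K * (`|F - G| + `|x - y|).
Proof.
move=> q0 C0 L0 M0 lipW.
(* The first two summands cover the immediate profit, whose margin is at most [M + C] in absolute
   value on [0, M]; the last covers the continuation value. *)
exists (1 + (M + C) * (1 + q) + L * (1 + q)).
  by rewrite !addr_ge0 ?mulr_ge0 //; lra.
move=> F G x y F01 G01 xM yM; rewrite /bellman_value.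
set W1 := W _; set W2 := W _.
have hW : `|W1 - W2| <= L * ((1 + q) * `|F - G| + `|x - y|).
  apply: (le_trans (lipW _ _ _ _)); try exact: next_adopters_in01.
  by rewrite ler_wpM2l // next_adopters_dist.
have := adopt_prob_dist _ p q F G x y q0.
have := adopt_prob_itv _ p q F x; have := adopt_prob_itv _ p q G y.
move: (adopt_prob p q G y) (adopt_prob p q F x) => s r s01 r01 rs.
have hyF : `|(y - C) * (1 - G)| <= M + C by rewrite ler_norml; nra.
have hr : `|r| <= 1 by rewrite ler_norml; lra.
have hy : `|y - C| <= M + C by rewrite ler_norml; lra.
have hF : `|1 - F| <= 1 by rewrite ler_norml; lra.
have h1 := ler_dist_mul _ ((x - C) * (1 - F)) _ _ s _ _ hyF hr.
have := ler_dist_mul _ (x - C) _ _ (1 - G) _ _ hy hF.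
have -> : x - C - (y - C) = x - y by ring.
have -> : 1 - F - (1 - G) = G - F by ring.
rewrite [`|G - F|]distrC => h2.
have -> : forall a b : R, a + W1 - (b + W2) = (a - b) + (W1 - W2).
  by move=> a b; ring.
apply: (le_trans (ler_normD _ _)).
have MC0 : 0 <= M + C by lra.
have h3 := ler_wpM2l MC0 rs.
have := normr_ge0 (F - G); have := normr_ge0 (x - y).
move: h1 h2 h3 hW; move: (`|F - G|) (`|x - y|) (`|_|) (`|_|) => d e A B.
move=> h1 h2 h3 hW e0 d0.
have : 0 <= (M + C) * (q * e) by rewrite !mulr_ge0.
have : 0 <= L * (q * e) by rewrite !mulr_ge0.
nra.
Qed.

(** * Existence of maximizing prices in a bounded range *)

Lemma lipschitz_continuous_within (R : realType) (f : R -> R) (A : set R) (K : R) :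
  0 <= K -> (forall x y, A x -> A y -> `|f x - f y| <= K * `|x - y|) ->
  {within A, continuous f}.
Proof.
move=> K0 lipf; apply/subspace_continuousP => x Ax.
apply/cvgrPdist_le => e e0; rewrite near_withinE; near=> y => Ay.
apply: (le_trans (lipf _ _ Ax Ay)).
(* Dividing by [K + 1] also handles [K = 0]. *)
have K1 : 0 < K + 1 by lra.
have : `|x - y| <= e / (K + 1).
  near: y; apply: cvgr_dist_le; first exact: cvg_id.
  by rewrite divr_gt0 //; lra.
rewrite ler_pdivlMr // => h; have := normr_ge0 (x - y); nra.
Unshelve. all: end_near. Qed.

(** Squaring [1 + u / 2 <= expR (u / 2)] gives quadratic growth, which yields an explicit
    threshold. *)
Lemma linear_le_expR (R : realType) (a b u : R) :
  1 <= a -> 1 <= b -> 8 * a * b <= u -> a * (u + b) <= expR u.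
Proof.
move=> a1 b1 hu.
have ab : 1 <= a * b by nra.
have u0 : 0 <= u by lra.
have -> : expR u = expR (u / 2) ^+ 2 by rewrite -expRM_natl; congr expR; lra.
have h := expR_ge1Dx (u / 2).
have : (1 + u / 2) ^+ 2 <= expR (u / 2) ^+ 2 by rewrite ler_sqr ?nnegrE; lra.
apply: le_trans.
have : 8 * (a * b) * u <= u * u by rewrite ler_wpM2r //; lra.
have : a <= a * b by nra.
nra.
Qed.

(* A price [x1 = C + L + 1] gains at least [(1 - F) R(F, x1)] over selling
   nothing, while a price [x] gains at most [(1 - F) R(F, x) (x - C + L)], which
   decays exponentially in [x], uniformly in [F]. *)
Lemma bellman_value_tail (R : realType) (p q C L : R) (W : R -> R) :
  0 <= p -> 0 <= q -> 0 <= C -> 0 <= L -> lipschitz01 R L W ->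
  exists2 M : R, C + L + 1 <= M & forall F x : R, 0 <= F <= 1 -> M <= x ->
    bellman_value p q C W F x <= bellman_value p q C W F (C + L + 1).
Proof.
move=> p0 q0 C0 L0 lipW.
(* [a] bounds the denominator of the adoption probability at [x1] for every [F] in [0, 1]; [b] is
   chosen so that [x - x1 + b = x - C + L]. *)
set a := 1 + expR (p + q); set b := 1 + 2 * L; set x1 := C + L + 1.
have a1 : 1 <= a by rewrite lerDl expR_ge0.
have b1 : 1 <= b by rewrite /b; lra.
exists (x1 + 8 * a * b).
  by rewrite lerDl !mulr_ge0 //; lra.
move=> F x F01 xM.
have hx := linear_le_expR _ a b (x - x1) a1 b1 ltac:(lra).
have eb : x - x1 + b = x - C + L by rewrite /b /x1; ring.
rewrite eb in hx.
have hW z : `|W (next_adopters p q F z) - W F|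
            <= L * ((1 - F) * adopt_prob p q F z).
  apply: (le_trans (lipW _ _ (next_adopters_in01 _ _ _ F01) F01)).
  rewrite ler_wpM2l // /next_adopters addrC addKr ger0_norm // mulr_ge0 //.
    by rewrite subr_ge0; have /andP[] := F01.
  by have /andP[/ltW] := adopt_prob_itv _ p q F z.
suff hr : adopt_prob p q F x * (x - C + L) <= adopt_prob p q F x1.
  rewrite /bellman_value.
  have := hW x; have := hW x1; rewrite !ler_norml => /andP[h1 _] /andP[_ h2].
  have F1 : 0 <= 1 - F by lra.
  have h3 := ler_wpM2l F1 hr.
  have e1 : (x1 - C) * (1 - F) * adopt_prob p q F x1
     = L * ((1 - F) * adopt_prob p q F x1) + (1 - F) * adopt_prob p q F x1.
    by rewrite /x1; ring.
  have e2 : (x - C) * (1 - F) * adopt_prob p q F x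
     = (1 - F) * (adopt_prob p q F x * (x - C + L))
       - L * ((1 - F) * adopt_prob p q F x).
    by ring.
  lra.
rewrite /adopt_prob.
have ex1 : expR (p + q * F - x1) = expR (p + q * F - x) * expR (x - x1).
  by rewrite -expRD; congr expR; ring.
have le_a : 1 + expR (p + q * F - x1) <= a.
  rewrite /a lerD2l ler_expR /x1.
  have : q * F <= q by nra.
  lra.
have e0 := expR_gt0 (p + q * F - x1).
have e0' := expR_gt0 (p + q * F - x).
move: ex1 le_a e0 e0' hx.
move: (expR (p + q * F - x1)) (expR (p + q * F - x)) (expR (x - x1)) => s r u.
move=> su sa s0 r0 hx.
have xCL : 0 <= x - C + L.
  have : 0 <= 8 * a * b by rewrite !mulr_ge0 //; lra.
  by rewrite -eb; lra.
(* With denominators cleared, the claim is [r * (x - C + L) * (1 + s) <= s * (1 + r)]; the left side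
   is at most [r * u = s]. *)
rewrite mulrAC ler_pdivrMr; last lra.
rewrite mulrAC ler_pdivlMr; last lra.
have h1 : (1 + s) * (x - C + L) <= u.
  by apply: le_trans hx; rewrite ler_wpM2r.
have h2 := ler_wpM2l (ltW r0) h1.
have h3 : s <= s * (1 + r) by rewrite ler_peMr; lra.
lra.
Qed.

Lemma bellman_value_max (R : realType) (p q C L : R) (W : R -> R) :
  0 <= p -> 0 <= q -> 0 <= C -> 0 <= L -> lipschitz01 R L W ->
  exists2 M : R, 0 <= M & forall F : R, 0 <= F <= 1 ->
    exists2 x : R, 0 <= x <= M & forall y : R, 0 <= y ->
      bellman_value p q C W F y <= bellman_value p q C W F x.
Proof.
move=> p0 q0 C0 L0 lipW.
have [M x1M tail] := bellman_value_tail _ p q C L W p0 q0 C0 L0 lipW.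
have M0 : 0 <= M by lra.
have [K K0 distK] := bellman_value_dist _ p q C L M W q0 C0 L0 M0 lipW.
exists M => // F F01.
have cont : {within `[0, M], continuous (bellman_value p q C W F)}.
  apply: (lipschitz_continuous_within _ _ _ _ K0) => x y /=.
  rewrite !in_itv /= => x0M y0M.
  by have := distK F F x y F01 F01 x0M y0M; rewrite subrr normr0 add0r.
have [x x0M xmax] := EVT_max M0 cont.
rewrite in_itv /= in x0M; exists x => // y y0.
(* A price above [M] does no better than [C + L + 1], which itself lies in [0, M]. *)
have [yM|/ltW My] := leP y M; first by apply: xmax; rewrite in_itv /= y0.
apply: (le_trans (tail _ _ F01 My)); apply: xmax; rewrite in_itv /=.
by rewrite x1M andbT; lra.
Qed.

(** * Value functions: regularity, attainment, monotonicity *)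

Lemma sup_eq_max (R : realType) (A : set R) (m : R) :
  A m -> ubound A m -> sup A = m.
Proof.
move=> Am ubm; apply/le_anti/andP; split; first by apply: ge_sup => //; exists m.
by apply: ub_le_sup => //; exists m.
Qed.

(** A maximizer makes the set of values nonempty and bounded above, so the default value of [sup]
    does not intervene. *)
Lemma sup_bellman_value (R : realType) (p q C : R) (W : R -> R) (F x : R) :
  0 <= x ->
  (forall y, 0 <= y -> bellman_value p q C W F y <= bellman_value p q C W F x) ->
  sup [set bellman_value p q C W F price
      | price in [set price : R | 0 <= price]] = bellman_value p q C W F x.
Proof.
by move=> x0 xmax; apply: sup_eq_max => [|_ [y y0 <-]]; [exists x|exact: xmax].
Qed.

Lemma profit_to_go_rem_lipschitz (R : realType) (p q C : R) (k : nat) :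
  0 <= p -> 0 <= q -> 0 <= C ->
  exists2 L : R, 0 <= L & lipschitz01 R L (profit_to_go_rem p q C k).
Proof.
move=> p0 q0 C0; elim: k => [|k [L L0 lipW]].
  by exists 0 => // F G _ _; rewrite subrr normr0 mul0r.
have [M M0 maxM] := bellman_value_max _ p q C L _ p0 q0 C0 L0 lipW.
have [K K0 distK] := bellman_value_dist _ p q C L M _ q0 C0 L0 M0 lipW.
exists K => //.
have le1 F G : 0 <= F <= 1 -> 0 <= G <= 1 ->
    profit_to_go_rem p q C k.+1 F - profit_to_go_rem p q C k.+1 G
    <= K * `|F - G|.
  move=> F01 G01 /=.
  have [x xM xmax] := maxM F F01; have [y yM ymax] := maxM G G01.
  have /andP[x0 _] := xM; have /andP[y0 _] := yM.
  rewrite (sup_bellman_value _ _ _ _ _ _ _ x0 xmax).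
  rewrite (sup_bellman_value _ _ _ _ _ _ _ y0 ymax).
  (* Charging at [G] the price [x] that is optimal at [F] bounds the difference of maxima by a
     difference of state-action values at one price in [0, M]. *)
  have := distK F G x x F01 G01 xM xM; rewrite subrr normr0 addr0.
  have := ymax x x0; have := ler_norm (bellman_value p q C
    (profit_to_go_rem p q C k) F x - bellman_value p q C
    (profit_to_go_rem p q C k) G x); lra.
move=> F G F01 G01; rewrite ler_norml le1 // andbT lerNl opprB distrC.
exact: le1.
Qed.

Lemma profit_to_go_rem_max (R : realType) (p q C : R) (k : nat) :
  0 <= p -> 0 <= q -> 0 <= C ->
  exists2 M : R, 0 <= M & forall F : R, 0 <= F <= 1 ->
    exists x : R,
      [/\ 0 <= x <= M,
          profit_to_go_rem p q C k.+1 F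
          = bellman_value p q C (profit_to_go_rem p q C k) F x
        & forall y : R, 0 <= y ->
            bellman_value p q C (profit_to_go_rem p q C k) F y
            <= bellman_value p q C (profit_to_go_rem p q C k) F x].
Proof.
move=> p0 q0 C0.
have [L L0 lipW] := profit_to_go_rem_lipschitz _ p q C k p0 q0 C0.
have [M M0 maxM] := bellman_value_max _ p q C L _ p0 q0 C0 L0 lipW.
exists M => // F /maxM[x xM xmax]; exists x; split => //=.
by have /andP[x0 _] := xM; exact: sup_bellman_value.
Qed.

Lemma profit_to_go_rem_nondecreasing (R : realType) (p q C : R) (k : nat) (F : R) :
  0 <= p -> 0 <= q -> 0 <= C -> 0 <= F <= 1 ->
  profit_to_go_rem p q C k F <= profit_to_go_rem p q C k.+1 F.
Proof.
move=> p0 q0 C0; elim: k F => [|k IH] F F01.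
  have [M _ /(_ F F01)[x [_ -> xmax]]] := profit_to_go_rem_max _ p q C 0 p0 q0 C0.
  (* The price [C] has zero margin, and the terminal value is 0. *)
  by apply: le_trans (xmax C C0); rewrite /bellman_value subrr !mul0r addr0.
have [_ _ /(_ F F01)[x [/andP[x0 _] -> _]]] :=
  profit_to_go_rem_max _ p q C k p0 q0 C0.
have [_ _ /(_ F F01)[y [_ -> ymax]]] :=
  profit_to_go_rem_max _ p q C k.+1 p0 q0 C0.
(* Reusing the optimal price [x] of the shorter horizon gives the same immediate profit, so only the
   continuation values at the same next state remain to be compared. *)
apply: le_trans (ymax x x0); rewrite /bellman_value lerD2l.
exact/IH/next_adopters_in01.
Qed.

Theorem proposition1 (R : realType) (p q C : R) (T : nat)
    (hp : 0 <= p) (hq : 0 <= q) (hC : 0 <= C) (hT : (1 <= T)%N) :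
  (forall t : nat, (t < T)%N ->
     exists2 price_max : R, 0 <= price_max &
       forall F : R, 0 <= F <= 1 ->
         exists price : R,
           [/\ 0 <= price <= price_max,
               profit_to_go p q C T t F = action_value p q C T t F price
             & forall price' : R, 0 <= price' ->
                 action_value p q C T t F price'
                 <= action_value p q C T t F price])
  /\
  (forall t : nat, (t.+1 < T)%N ->
     forall F : R, 0 <= F <= 1 ->
       profit_to_go p q C T t.+1 F <= profit_to_go p q C T t F).
Proof.
split=> t tT; rewrite /action_value /profit_to_go.
  (* [T - t] is rewritten as the successor of [T - t.+1], exposing one Bellman step. *)
  by rewrite -(subnSK tT); exact: profit_to_go_rem_max.
move=> F F01; rewrite -(subnSK (ltnW tT)).
exact: profit_to_go_rem_nondecreasing.
Qed.
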